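(* Let $\varphi$ be a Möbius transform of the unit ball and let $\lambda=\varphi^{-1}(0)$. Then $U_\varphi\{k_0\}^\perp=\{k_\lambda\}^\perp$.
   Context: $B_d$ is the open unit ball of $\mathbb{C}^d$. $H_d^2$ is the Hilbert space of holomorphic functions on $B_d$ with reproducing kernel $k(z,\lambda)=\frac{1}{1-\langle z,\lambda\rangle}$, and $k_\lambda=k(\cdot,\lambda)$; orthogonal complements are taken in $H_d^2$. A Möbius transform is a continuous bijection $\varphi:\overline{B_d}\to\overline{B_d}$ that is holomorphic in $B_d$ and satisfies $\varphi(B_d)=B_d$, $\varphi(\partial B_d)=\partial B_d$. For a Möbius transform $\varphi$ with $\lambda=\varphi^{-1}(0)$, $U_\varphi$ is the unitary operator on the Hilbert space $H_d^2$ given by $U_\varphi\xi=(\xi\circ\varphi)\frac{k_\lambda}{\|k_\lambda\|}$. *)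

(* Defs.v *)
From HB Require Import structures.
From mathcomp Require Import all_boot all_order all_algebra.
From mathcomp Require Import complex.
From mathcomp Require Import all_classical all_reals all_analysis.

Set Implicit Arguments.
Unset Strict Implicit.
Unset Printing Implicit Defensive.

Import Order.TTheory GRing.Theory Num.Theory.
Import numFieldNormedType.Exports.

Local Open Scope classical_set_scope.
Local Open Scope ring_scope.

(* Naming the structure lets the topology of [R[i]] be inferred from its being
   a [numClosedFieldType]. *)
Definition Cplx (R : realType) : numClosedFieldType := R[i].

(* [C^d] is ['rV[Cplx R]_d].  The library norm on row vectors is the sup norm,
   which is right for topology and differentiability but not for balls, so the
   Euclidean norm is taken from [dotmx z w = \sum_i z_i * (w_i)^*], which is
   linear in its first argument. *)
Section Ball.
Context {R : realType} {d : nat}.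
Implicit Types z : 'rV[Cplx R]_d.

Definition enorm z : Cplx R := sqrtC (dotmx z z).

Definition oball : set 'rV[Cplx R]_d := [set z | enorm z < 1].
Definition cball : set 'rV[Cplx R]_d := [set z | enorm z <= 1].
Definition bsphere : set 'rV[Cplx R]_d := [set z | enorm z = 1].

(* [differentiable] is Frechet differentiability over the scalar field [Cplx R],
   so this is holomorphy; the set [A] is meant to be open. *)
Definition holomorphic_on {V : normedModType (Cplx R)} (A : set 'rV[Cplx R]_d)
    (f : 'rV[Cplx R]_d -> V) : Prop :=
  forall z, A z -> differentiable f z.

(* The values of [phi] outside the closed ball are irrelevant. *)
Record mobius_transform (phi : 'rV[Cplx R]_d -> 'rV[Cplx R]_d) : Prop := {
  mobius_bij : set_bij cball cball phi;
  mobius_continuous : {within cball, continuous phi};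
  mobius_holomorphic : holomorphic_on oball phi;
  mobius_ball : phi @` oball = oball;
  mobius_sphere : phi @` bsphere = bsphere }.

End Ball.

(* The Hilbert space of holomorphic functions on the open ball of [C^d] with
   reproducing kernel [1 / (1 - <z, w>)].  A reproducing kernel determines its
   Hilbert space of functions, so any two inhabitants describe the same space.
   [da_eval f] represents the function [f]; only its values on the open ball
   matter, and [da_eval_inj] says that they determine [f]. *)
Record drury_arveson (R : realType) (d : nat) := DruryArveson {
  da_space :> completeNormedModType (Cplx R);
  da_dot : {dot da_space for Num.conj};
  da_norm : forall f : da_space, `|f| ^+ 2 = da_dot f f;
  da_eval : da_space -> 'rV[Cplx R]_d -> Cplx R;
  da_eval_linear : forall (a : Cplx R) (f g : da_space) z, oball z ->
    da_eval (a *: f + g) z = a * da_eval f z + da_eval g z;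
  da_eval_inj : forall f g : da_space,
    (forall z, oball z -> da_eval f z = da_eval g z) -> f = g;
  da_eval_holomorphic : forall f : da_space,
    holomorphic_on (V := (Cplx R)^o) oball (da_eval f);
  da_kernel : 'rV[Cplx R]_d -> da_space;
  da_kernelE : forall w z, oball w -> oball z ->
    da_eval (da_kernel w) z = 1 / (1 - dotmx z w);
  da_reproducing : forall (f : da_space) w, oball w ->
    da_dot f (da_kernel w) = da_eval f w }.

Section Operators.
Context {R : realType} {d : nat} (H : drury_arveson R d).

Definition orthogonal_complement (A : set H) : set H :=
  [set f | forall g, A g -> da_dot H f g = 0].

Definition unitary_operator (U : {linear H -> H}) : Prop :=
  isometry (da_dot H) (da_dot H) U /\ set_surj setT setT U.

(* [U] is the unitary operator
   [U_phi xi = (xi \o phi) * k_lam / |k_lam|], where [lam = phi^-1(0)];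
   the formula determines [U] by [da_eval_inj]. *)
Definition is_U_mobius (phi : 'rV[Cplx R]_d -> 'rV[Cplx R]_d)
    (lam : 'rV[Cplx R]_d) (U : {linear H -> H}) : Prop :=
  unitary_operator U /\
  forall (xi : H) z, oball z ->
    da_eval (U xi) z =
    da_eval xi (phi z) * (da_eval (da_kernel H lam) z / `|da_kernel H lam|).

End Operators.

(* Main.v *)
Require Import Defs.
From mathcomp Require Import all_boot all_order all_algebra.
From mathcomp Require Import complex.
From mathcomp Require Import all_classical all_reals all_analysis.
Import Order.TTheory GRing.Theory Num.Theory.
Import numFieldNormedType.Exports.
Local Open Scope classical_set_scope.
Local Open Scope ring_scope.

(** The reproducing property turns orthogonality to [k_w] into vanishing at [w].
    Evaluating [U f] at [lam], where the argument [phi lam] is the origin, gives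
    [<U f, k_lam> = f(0) * k_lam(lam) / |k_lam| = <f, k_0> * |k_lam|],
    and [|k_lam|] is nonzero.  Hence [U f] is orthogonal to [k_lam] exactly when
    [f] is orthogonal to [k_0], and since [U] is surjective this equivalence of
    conditions is the equality of the two sets.

    The reproducing property at [lam] requires [lam] to lie in the open ball:
    the origin is the image of a point of the open ball, and by injectivity of
    [phi] on the closed ball that point is [lam]. *)

Lemma oball_cball (R : realType) (d : nat) : @oball R d `<=` cball.
Proof. by move=> z; exact: ltW. Qed.

Lemma oball0 (R : realType) (d : nat) : oball (0 : 'rV[Cplx R]_d).
Proof. by rewrite /oball /= /enorm linear0r sqrtC0 ltr01. Qed.

Lemma mobius_zero_oball {R : realType} {d : nat}
    {phi : 'rV[Cplx R]_d -> 'rV[Cplx R]_d} {lam : 'rV[Cplx R]_d} :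
  mobius_transform phi -> cball lam -> phi lam = 0 -> oball lam.
Proof.
move=> [[_ phi_inj _] _ _ phi_ball _] lam_c phi_lam.
have [mu mu_o phi_mu] : (phi @` oball) 0 by rewrite phi_ball; exact: oball0.
suff -> : lam = mu by [].
apply: phi_inj; rewrite ?inE ?phi_lam ?phi_mu //.
exact: oball_cball.
Qed.

Section Kernel.
Context {R : realType} {d : nat} (H : drury_arveson R d).

Lemma da_norm_kernel (w : 'rV[Cplx R]_d) : oball w ->
  `|da_kernel H w| ^+ 2 = da_eval (da_kernel H w) w.
Proof. by move=> w_o; rewrite da_norm da_reproducing. Qed.

(** By the reproducing property [|k_w|^2 = k_w(w) = 1 / (1 - <w, w>)], and
    [<w, w> = 1] would put [w] on the sphere. *)
Lemma da_norm_kernel_neq0 {w : 'rV[Cplx R]_d} : oball w ->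
  `|da_kernel H w| != 0.
Proof.
move=> w_o; rewrite -sqrf_eq0 da_norm_kernel // da_kernelE // mul1r invr_eq0.
rewrite subr_eq0; apply/eqP => w_unit; move: w_o.
by rewrite /oball /= /enorm -w_unit sqrtC1 ltxx.
Qed.

(** Pairing with [k_lam] evaluates [U f] at [lam]; there the
    composition with [phi] becomes evaluation at the origin, and the weight
    [k_lam(lam) / |k_lam|] simplifies to [|k_lam|]. *)
Lemma da_dot_U_mobius_kernel {phi : 'rV[Cplx R]_d -> 'rV[Cplx R]_d}
    {lam : 'rV[Cplx R]_d} {U : {linear H -> H}} (f : H) :
  oball lam -> phi lam = 0 -> is_U_mobius phi lam U ->
  da_dot H (U f) (da_kernel H lam) =
  da_dot H f (da_kernel H 0) * `|da_kernel H lam|.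
Proof.
move=> lam_o phi_lam [_ UE].
rewrite !da_reproducing //; last exact: oball0.
rewrite UE // phi_lam -da_norm_kernel // expr2 mulfK //.
exact: da_norm_kernel_neq0.
Qed.

Lemma orthogonal_complement1 (f g : H) :
  orthogonal_complement [set g] f <-> da_dot H f g = 0.
Proof. by split=> [/(_ _ erefl)//|fg _ ->]. Qed.

End Kernel.

Theorem corollary3p4 (R : realType) (d : nat) (H : drury_arveson R d)
    (phi : 'rV[Cplx R]_d -> 'rV[Cplx R]_d) (lam : 'rV[Cplx R]_d)
    (U : {linear H -> H}) :
  mobius_transform phi ->
  cball lam -> phi lam = 0 ->
  is_U_mobius phi lam U ->
  U @` orthogonal_complement [set da_kernel H 0] =
  orthogonal_complement [set da_kernel H lam].
Proof.
move=> phi_mobius lam_c phi_lam U_mobius.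
have lam_o := mobius_zero_oball phi_mobius lam_c phi_lam.
have U_orth f : orthogonal_complement [set da_kernel H lam] (U f) <->
    orthogonal_complement [set da_kernel H 0] f.
  rewrite !orthogonal_complement1.
  rewrite (da_dot_U_mobius_kernel H f lam_o phi_lam U_mobius).
  split=> [/eqP|->]; last by rewrite mul0r.
  by rewrite mulf_eq0 (negPf (da_norm_kernel_neq0 H lam_o)) orbF => /eqP.
have [[_ U_surj] _] := U_mobius.
apply/seteqP; split=> [_ [f /U_orth f_orth <-] //|g g_orth].
have [f _ Uf] := U_surj g Logic.I.
by exists f => //; apply/U_orth; rewrite Uf.
Qed.
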